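(* Let $s\in\mathbb{N}$. For any $\epsilon>0$ there is a threshold $\underline{m}_{\epsilon,s}$ depending only on $\epsilon$ and $s$ such that the following holds for every $m\ge\underline{m}_{\epsilon,s}$. Let $C_1,\dots,C_s$ be independently drawn from the uniform distribution on $\{0,1\}^{m\times m}$ and let $\mathcal{C}=(C_1,\dots,C_s)$. Then there is a set $\mathcal{C}^*\subseteq(\{0,1\}^{m\times m})^s$ with $$\Pr(\mathcal{C}\in\mathcal{C}^* )\ge 1-\frac{1}{(s-1)!\,m}-m^{3s}2^{-2\epsilon m}$$ such that, for all $\mathcal{C}\in\mathcal{C}^*$ and all pairs of distinct nonzero $\boldsymbol{k}_1,\boldsymbol{k}_2\in\mathbb{N}_0^s$, $$\Pr\bigl(\mathcal{Z}(\boldsymbol{k}_1,\mathcal{C})\cap\mathcal{Z}(\boldsymbol{k}_2,\mathcal{C})\mid\mathcal{C}\bigr)\le2^{-2(1-\epsilon)m}.$$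
   Context: $\mathbb{N}_0=\{0,1,2,\dots\}$. Let $M_1,\dots,M_s\in\{0,1\}^{\infty\times m}$ be random matrices with ones on the diagonal, zeros above the diagonal, and uniform random elements of $\{0,1\}$ below the diagonal, all these random entries being mutually independent and independent of $\mathcal{C}$. For $k\in\mathbb{N}_0$ with binary expansion $k=\sum_{\ell\ge1}a_\ell2^{\ell-1}$, $a_\ell\in\{0,1\}$, let $\vec k=(a_1,a_2,\dots)^{\mathsf T}$. For $\boldsymbol{k}=(k_1,\dots,k_s)\in\mathbb{N}_0^s$, $\mathcal{Z}(\boldsymbol{k},\mathcal{C})$ is the event that $\sum_{j=1}^s\vec k_j^{\mathsf T}M_jC_j=\boldsymbol{0}\bmod2$. Conditionally on $\mathcal{C}$, the probability is over $M_1,\dots,M_s$. *)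

(* Defs.v *)
From HB Require Import structures.
From mathcomp Require Import all_boot all_order all_algebra finmap.
From mathcomp Require Import all_classical all_reals all_analysis.

Set Implicit Arguments.
Unset Strict Implicit.
Unset Printing Implicit Defensive.

Import Order.TTheory GRing.Theory Num.Theory.
Local Open Scope classical_set_scope.
Local Open Scope ring_scope.

(* Arithmetic mod 2 on {0,1} is arithmetic in 'F_2, so {0,1}^{m x m} is
   'M['F_2]_m, and an element of {0,1}^{oo x m} is its sequence of rows,
   of type nat -> 'rV['F_2]_m.  All indices start from 0. *)

Section probability.
Context (d : measure_display) (Omega : measurableType d) (R : realType).
Variable P : probability Omega R.

(* The sigma-algebra on Omega generated by X, T being discrete. *)
Definition sigma_rv (T : Type) (X : Omega -> T) : set (set Omega) :=
  preimage_set_system setT X setT.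

(* X is a random variable with values in the finite set T, with the uniform
   distribution. *)
Definition uniform_rv (T : finType) (X : Omega -> T) : Prop :=
  sigma_rv X `<=` measurable /\
  forall t : T, P (X @^-1` [set t]) = ((#|T|%:R : R)^-1)%:E.

(* Mutual independence of the (sub-sigma-algebras) F i, for i in D. *)
Definition mutually_independent (I : choiceType) (D : set I)
    (F : I -> set (set Omega)) : Prop :=
  forall (J : {fset I}) (E : I -> set Omega),
    [set` J] `<=` D -> (forall i, i \in J -> F i (E i)) ->
    P (\bigcap_(i in [set` J]) E i) = (\prod_(i <- J) P (E i))%E.

(* P(A | B), meaningful when P B > 0. *)
Definition cond_prob (A B : set Omega) : R :=
  fine (P (A `&` B)) / fine (P B).

End probability.

Section model.
Context (d : measure_display) (Omega : measurableType d) (R : realType).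
Variables (P : probability Omega R) (s m : nat).
Variables (C : Omega -> {ffun 'I_s -> 'M['F_2]_m})
          (M : 'I_s -> Omega -> nat -> 'rV['F_2]_m).

(* Index set of the mutually independent family formed by the matrices C_j
   (inl j) and the entries (l, i) of M_j (inr (j, l, i)), where only the
   entries below the diagonal, i < l, are considered. *)
Definition family_dom : set ('I_s + 'I_s * nat * 'I_m)%type :=
  [set x | if x is inr (_, l, i) then ((i : 'I_m) < l)%N else true].

Definition family_sigma (x : 'I_s + 'I_s * nat * 'I_m) : set (set Omega) :=
  match x with
  | inl j => sigma_rv (fun w => C w j)
  | inr (j, l, i) => sigma_rv (fun w => M j w l 0 i)
  end.

Record random_model : Prop := RandomModel {
  C_uniform : forall j, uniform_rv P (fun w => C w j) ;
  M_diag : forall j w (i : 'I_m), M j w i 0 i = 1 ;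
  M_above : forall j w l (i : 'I_m), (l < i)%N -> M j w l 0 i = 0 ;
  M_below : forall j l (i : 'I_m), (i < l)%N ->
    uniform_rv P (fun w => M j w l 0 i) ;
  CM_independent : mutually_independent P family_dom family_sigma }.

(* The coefficient of 2 ^ l in the binary expansion of k. *)
Definition digit (k l : nat) : 'F_2 := (odd (k %/ 2 ^ l))%:R.

Lemma digit_eq0 k l : (k <= l)%N -> digit k l = 0.
Proof.
by move=> kl; rewrite /digit divn_small// (leq_ltn_trans kl)// ltn_expl.
Qed.

(* The product of the row vector of the digits of k by an oo x m matrix; the
   digits of index >= k vanish (digit_eq0). *)
Definition digits_mul (k : nat) (A : nat -> 'rV['F_2]_m) : 'rV['F_2]_m :=
  \sum_(l < k) digit k l *: A l.

Definition event_Z (k : {ffun 'I_s -> nat}) : set Omega :=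
  [set w | \sum_(j < s) digits_mul (k j) (M j w) *m C w j = 0].

End model.

(* Main.v *)
Require Import Defs.
From HB Require Import structures.
From mathcomp Require Import all_boot all_order all_algebra finmap.
From mathcomp Require Import zify ring.
From mathcomp Require Import all_classical all_reals all_analysis.

Set Implicit Arguments.
Unset Strict Implicit.
Unset Printing Implicit Defensive.

Import Order.TTheory GRing.Theory Num.Theory.
Local Open Scope classical_set_scope.
Local Open Scope ring_scope.

(** The two events only involve finitely many rows of the matrices M_j, say the
    rows l < L, so everything is uniform counting over pairs (c, N), where c is
    a value of the C_j and N is an array of bits that fills the entries of the
    M_j below the diagonal.  Write kappa_{j,l} in F_2^2 for the pair of digits of
    weight 2^l of the j-th components of k1 and k2, and V_j for the 2 x m matrix
    sum_l kappa_{j,l} (row l of M_j).  Both events occur when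
    sum_j V_j C_j = 0.  Three facts give the theorem.

    Average over C.  Since k1, k2 and k1 xor k2 are nonzero, the probability over
    C and M together is at most 5 * 2^(-2m) (sum_card_solutions).  For fixed M,
    the probability over C is 2^(-rm) with r the rank of the joint family V.
    Here rank 2 contributes at most 2^(-2m).  The rank is smaller only if one of
    the three nonzero combinations xi V vanishes.  The last row of M_j that occurs
    in xi V_j carries a fixed 1 on the diagonal, unless its index is at
    least m; so xi V can only vanish through rows of index at least m,
    which are entirely uniform, and this has probability at most 2^(-m)
    for each xi, and at most 2^(-2m) for V = 0 (card_row_comb_eq0).

    Few types.  Expand the indicator of sum_j V_j C_j = 0 in characters and
    average over the independent entries of the M_j.  The digits of k1 and k2
    then enter only through the binary lengths, capped at m + 1, of the j-th
    components of k1, k2 and k1 xor k2 (card_solutions_fourier,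
    prod_entry_mean).  Two of these three lengths are equal, so a pair (k1, k2)
    gives, as a function of C, one of at most (4 (m+2)^2)^s conditional
    probabilities (solutions_type).

    Markov and union bound.  For each type, the average bound shows that a
    proportion at most 5 * 2^(-2 eps m) of the matrices C violate the desired
    inequality.  Summing over the types gives 5 (4 (m+2)^2)^s 2^(-2 eps m), which
    is at most m^(3s) 2^(-2 eps m) once m >= 24. *)

(** * Counting solutions of linear systems *)

(** Each fibre of f has as many elements as the fibre over 0, since act h moves
    the latter into the fibre over h; this plays the part of the first
    isomorphism theorem when f is merely affine. *)
Lemma card_kernel_free_action (G : finType) (H : finZmodType) (f : G -> H)
    (act : H -> G -> G) :
  (forall h, injective (act h)) -> (forall h g, f (act h g) = f g + h) ->
  (#|[set g | f g == 0%R]%SET| * #|H| <= #|G|)%N.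
Proof.
move=> act_inj f_act.
rewrite -[#|H|]cardsT -cardsX -(card_in_imset (f := fun u => act u.2 u.1)).
  exact: max_card.
move=> [g h] [g' h'] /setXP[/=]; rewrite inE => /eqP g0 _ /setXP[/=].
rewrite inE => /eqP g'0 _ /[dup] e /(congr1 f).
rewrite !f_act g0 g'0 !add0r => hh'; congr pair => //.
by apply: (act_inj h); rewrite e hh'.
Qed.

(** A family of vectors that no nonzero linear form annihilates spans.  The right
    inverse B tells how to move a point so as to change the value of
    g |-> sum_i v_i g_i by a prescribed amount. *)
Lemma spanning_right_inverse (F : fieldType) (I : finType) (r : nat)
    (v : I -> 'cV[F]_r) :
  (forall xi : 'rV_r, (forall i, xi *m v i = 0) -> xi = 0) ->
  exists B : I -> 'rV_r, \sum_i v i *m B i = 1%:M.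
Proof.
move=> v_span.
pose A := \matrix_(a < r, t < #|I|) v (enum_val t) a 0.
have colA t : col t A = v (enum_val t).
  by apply/colP => a; rewrite !mxE.
have /row_freeP[B AB] : row_free A.
  apply: inj_row_free => xi xiA; apply: v_span => i.
  by rewrite -(enum_rankK i) -colA colE mulmxA xiA mul0mx.
exists (fun i => row (enum_rank i) B).
rewrite -AB; apply/matrixP => a b; rewrite summxE !mxE.
rewrite (reindex (@enum_val _ (mem I))) /=; last exact/onW_bij/enum_val_bij.
by apply: eq_bigr => t _; rewrite !mxE big_ord1 !mxE enum_valK.
Qed.

Section linear_systems.
Variables (s m : nat).
Local Notation mats := {ffun 'I_s -> 'M['F_2]_m}.

Lemma card_left_kernel (r : nat) (V : 'I_s -> 'M['F_2]_(r, m)) :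
  (forall xi : 'rV_r, (forall j, xi *m V j = 0) -> xi = 0) ->
  (#|[set c : mats | (\sum_j V j *m c j == 0)%R]%SET| * 2 ^ (r * m)
    <= #|{: mats}|)%N.
Proof.
move=> V_span.
have [|B VB] := @spanning_right_inverse _ ('I_s * 'I_m)%type _
    (fun u => col u.2 (V u.1)).
  move=> xi xiV; apply: V_span => j; apply/rowP => i.
  have := xiV (j, i); rewrite colE mulmxA -colE => /colP/(_ 0).
  by rewrite !mxE.
have -> : (2 ^ (r * m) = #|{: 'M['F_2]_(r, m)}|)%N by rewrite card_mx card_Fp.
pose act (h : 'M['F_2]_(r, m)) (c : mats) : mats :=
  [ffun j => c j + \matrix_i (B (j, i) *m h)].
apply: (@card_kernel_free_action _ _ (fun c : mats => \sum_j V j *m c j) act).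
  move=> h c c' /ffunP cc'; apply/ffunP => j.
  by have := cc' j; rewrite !ffunE => /addIr.
move=> h c; rewrite -[X in _ + X]mul1mx -VB mulmx_suml.
rewrite [X in _ + X](eq_bigr
  (fun u => col u.2 (V u.1) *m B (u.1, u.2) *m h)); last by case.
rewrite -(pair_bigA _ (fun j i => col i (V j) *m B (j, i) *m h)) -big_split /=.
apply: eq_bigr => j _; rewrite ffunE mulmxDr; congr (_ + _).
apply/matrixP => a b; rewrite !mxE summxE; apply: eq_bigr => i _.
by rewrite -mulmxA !mxE big_ord1 !mxE.
Qed.

(** The three terms are the bounds for rank 2, 1 and 0; the sum over xi is
    positive exactly when the rank of the family V is at most 1. *)
Lemma card_left_kernel_rank (V : 'I_s -> 'M['F_2]_(2, m)) :
  (#|[set c : mats | (\sum_j V j *m c j == 0)%R]%SET| * 2 ^ (2 * m) <=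
   #|{: mats}| * (1 + 2 ^ m * (\sum_(xi : 'rV['F_2]_2 | (xi != 0)%R)
     [forall j, xi *m V j == 0%R]) + 2 ^ (2 * m) * [forall j, V j == 0%R]))%N.
Proof.
have [_|] := boolP [forall j, V j == 0].
  by apply: leq_mul; rewrite ?max_card// muln1 leq_addl.
move=> /forallPn[j0 Vj0].
have [V_span|] := pselect
  (forall xi : 'rV_2, (forall j, xi *m V j = 0) -> xi = 0).
  apply: leq_trans (card_left_kernel V_span) _.
  by rewrite leq_pmulr// -addnA.
move=> /existsNP[xi /not_implyP[xiV /eqP xi0]].
have [a Va] : exists a, row a (V j0) != 0.
  apply/existsP; apply: contraR Vj0 => /existsPn V0.
  apply/eqP/row_matrixP => a; rewrite row0; apply/eqP.
  by have := V0 a; case: eqP.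
have /card_left_kernel : forall zeta : 'rV['F_2]_1,
    (forall j, zeta *m row a (V j) = 0) -> zeta = 0.
  move=> zeta /(_ j0); rewrite [zeta]mx11_scalar mul_scalar_mx => /eqP.
  by rewrite scalemx_eq0 (negPf Va) orbF => /eqP->; rewrite raddf0.
rewrite mul1n => card_a; rewrite mulSn mul1n expnD mulnA.
apply: (@leq_trans (#|{: mats}| * 2 ^ m)); last first.
  rewrite leq_mul2l; apply/orP; right.
  rewrite addnAC; apply: leq_trans (leq_addl _ _); apply: leq_pmulr.
  rewrite (bigD1 xi)//= (introT forallP) // => j; exact/eqP.
rewrite leq_mul2r; apply/orP; right; apply: leq_trans card_a.
rewrite leq_mul2r; apply/orP; right; apply/subset_leq_card/fintype.subsetP => c.
rewrite !inE => /eqP Vc0; apply/eqP.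
under eq_bigr do rewrite -row_mul.
by rewrite -(raddf_sum (row a)) Vc0 raddf0.
Qed.

End linear_systems.

(** * Random unitriangular matrices *)

Section unitriangular_matrices.
Variables (s m L : nat).
Local Notation mats := {ffun 'I_s -> 'M['F_2]_m}.
Local Notation arrays := {ffun 'I_s * 'I_L * 'I_m -> 'F_2}.

Definition below (u : 'I_s * 'I_L * 'I_m) : bool := (u.2 < u.1.2)%N.

(** The entries of N on and above the diagonal are ignored: they only make the
    space of arrays a product, without changing the law of the result. *)
Definition unitriangular (N : arrays) : arrays :=
  [ffun u : 'I_s * 'I_L * 'I_m =>
    if below u then N u else ((u.1.2 : nat) == u.2)%:R].

Definition row_comb (r : nat) (kappa : 'I_s -> nat -> 'cV['F_2]_r) (X : arrays)
    (j : 'I_s) : 'M['F_2]_(r, m) :=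
  \sum_(l < L) kappa j l *m \row_i X (j, l, i).

(** The rows of index at least m lie entirely below the diagonal, hence are free;
    if their coefficients span, they can be moved so as to reach every value. *)
Lemma card_row_comb_eq0_free (r : nat) (kappa : 'I_s -> nat -> 'cV['F_2]_r) :
  (forall xi : 'rV_r,
    (forall j (l : 'I_L), (m <= l)%N -> xi *m kappa j l = 0) -> xi = 0) ->
  (#|[set N : arrays |
      [forall j, row_comb kappa (unitriangular N) j == 0%R]]%SET| * 2 ^ (r * m)
    <= #|{: arrays}|)%N.
Proof.
move=> kappa_span.
have [|B kB] := @spanning_right_inverse _ ('I_s * 'I_L)%type _
    (fun u => if (m <= u.2)%N then kappa u.1 u.2 else 0).
  move=> xi xik; apply: kappa_span => j l ml.
  by have := xik (j, l); rewrite /= ml.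
have -> : (2 ^ (r * m) = #|{: 'M['F_2]_(r, m)}|)%N by rewrite card_mx card_Fp.
pose act (h : 'M['F_2]_(r, m)) (N : arrays) : arrays :=
  [ffun u => N u + if (m <= u.1.2)%N then (B u.1 *m h) 0 u.2 else 0].
apply: leq_trans (@card_kernel_free_action _ _
  (fun N : arrays => \sum_j row_comb kappa (unitriangular N) j) act _ _).
- rewrite leq_mul2r; apply/orP; right.
  apply/subset_leq_card/fintype.subsetP => N.
  by rewrite !inE => /forallP N0; rewrite big1// => j _; apply/eqP.
- move=> h N N' /ffunP NN'; apply/ffunP => u.
  by have := NN' u; rewrite !ffunE => /addIr.
move=> h N; rewrite -[X in _ + X]mul1mx -kB mulmx_suml.
rewrite [X in _ + X](eq_bigr (fun u : 'I_s * 'I_L =>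
  (if (m <= u.2)%N then kappa u.1 u.2 else 0) *m B (u.1, u.2) *m h));
  last by case.
rewrite -(pair_bigA _ (fun j (l : 'I_L) =>
  (if (m <= l)%N then kappa j l else 0) *m B (j, l) *m h)) -big_split /=.
apply: eq_bigr => j _; rewrite /row_comb -big_split /=.
apply: eq_bigr => l _; case: leqP => ml; last first.
  rewrite !mul0mx addr0; congr (_ *m _); apply/rowP => i; rewrite !mxE !ffunE/=.
  by rewrite (leqNgt m) ml addr0.
rewrite -mulmxA -mulmxDr; congr (_ *m _).
apply/rowP => i; rewrite !mxE !ffunE/=.
by rewrite /below /= ml (leq_trans (ltn_ord i) ml) !mxE.
Qed.

Lemma row_combZ (r r' : nat) (xi : 'M['F_2]_(r', r)) kappa (X : arrays) j :
  row_comb (fun j l => xi *m kappa j l) X j = xi *m row_comb kappa X j.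
Proof. by rewrite mulmx_sumr; apply: eq_bigr => l _; rewrite mulmxA. Qed.

(** For digits t of k, this p is the length of the binary expansion of k. *)
Definition digit_length (r : nat) (t : nat -> 'cV['F_2]_r) (p : nat) :=
  (forall l, (p <= l)%N -> t l = 0) /\ ((0 < p)%N -> t p.-1 != 0).

Lemma digit_length_exists (r : nat) (t : nat -> 'cV['F_2]_r) (q : nat) :
  (forall l, (q <= l)%N -> t l = 0) -> exists2 p, digit_length t p & (p <= q)%N.
Proof.
elim: q => [|q IH] tq; first by exists 0%N.
have [t0|t0] := eqVneq (t q) 0; last by exists q.+1.
have [|p ? pq] := IH; last by exists p => //; exact: ltnW.
by move=> l; rewrite leq_eqVlt => /predU1P[<-//|/tq].
Qed.

(** Column i of a unitriangular matrix is 1 in row i and 0 in the rows before;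
    the later rows have zero coefficients. *)
Lemma row_comb_last (r : nat) (kappa : 'I_s -> nat -> 'cV['F_2]_r) (N : arrays)
    (j : 'I_s) (i : 'I_m) :
  (i < L)%N -> digit_length (kappa j) i.+1 ->
  col i (row_comb kappa (unitriangular N) j) = kappa j i.
Proof.
move=> iL [kp _]; apply/colP => a.
rewrite !mxE summxE (bigD1 (Ordinal iL))//= big1 ?addr0.
  by rewrite !mxE big_ord1 !mxE ffunE /below /= ltnn eqxx mulr1.
move=> l /eqP/val_eqP/=; rewrite neq_ltn => /orP[li|il].
  rewrite !mxE big_ord1 !mxE ffunE /below /= ltnNge (ltnW li)/=.
  by rewrite ltn_eqF// mulr0.
by rewrite kp// mul0mx mxE.
Qed.

Lemma row_comb_neq0 (r : nat) (kappa : 'I_s -> nat -> 'cV['F_2]_r) (N : arrays)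
    (j : 'I_s) (l : nat) :
  (forall l, (L <= l)%N -> kappa j l = 0) ->
  (forall l, (m <= l)%N -> kappa j l = 0) ->
  kappa j l != 0 -> row_comb kappa (unitriangular N) j != 0.
Proof.
move=> kL km kl.
have [|p kp pq] := @digit_length_exists _ (kappa j) (minn L m).
  by move=> l'; rewrite geq_min => /orP[/kL|/km].
move: pq; rewrite leq_min => /andP[pL pm].
case: p kp pL pm => [[k0 _]|i kp pL pm]; first by rewrite k0 ?eqxx in kl.
apply: contraTneq (kp.2 isT) => V0.
by rewrite -(@row_comb_last _ kappa N j (Ordinal pm))// V0 col0 eqxx.
Qed.

(** If the coefficients of the free rows do not span, then some xi kappa is
    nonzero but supported on rows of index less than m; its last row then puts a
    1 in xi V, and there is no array to count. *)
Lemma card_row_comb_eq0 (r : nat) (kappa : 'I_s -> nat -> 'cV['F_2]_r) :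
  (forall j l, (L <= l)%N -> kappa j l = 0) ->
  (forall xi : 'rV_r, xi != 0 -> exists j l, xi *m kappa j l != 0) ->
  (#|[set N : arrays |
      [forall j, row_comb kappa (unitriangular N) j == 0%R]]%SET| * 2 ^ (r * m)
    <= #|{: arrays}|)%N.
Proof.
move=> kL k_span; have [|] := pselect (forall xi : 'rV_r,
    (forall j (l : 'I_L), (m <= l)%N -> xi *m kappa j l = 0) -> xi = 0).
  exact: card_row_comb_eq0_free.
move=> /existsNP[xi /not_implyP[xi_m /eqP xi0]].
have [j [l xil]] := k_span xi xi0.
rewrite (_ : [set N : arrays |
    [forall j, row_comb kappa (unitriangular N) j == 0]]%SET = finset.set0);
  rewrite ?cards0//; apply/setP => N.
rewrite !inE; apply/negbTE/forallP => /(_ j)/eqP V0.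
suff: row_comb (fun j l => xi *m kappa j l) (unitriangular N) j != 0.
  by rewrite row_combZ V0 mulmx0 eqxx.
apply: (@row_comb_neq0 _ _ _ _ l) => // {xil}l' Ll'.
  by rewrite kL// mulmx0.
have [ll'|] := ltnP l' L; last by move/kL->; rewrite mulmx0.
exact: (xi_m j (Ordinal ll')).
Qed.

Definition solutions (r : nat) (kappa : 'I_s -> nat -> 'cV['F_2]_r) (c : mats) :
    {set arrays} :=
  [set N | \sum_j row_comb kappa (unitriangular N) j *m c j == 0]%SET.

(** In 5 = 1 + 3 + 1, the middle term counts the nonzero linear forms xi on
    F_2^2, which are the three ways to have rank at most 1. *)
Lemma sum_card_solutions (kappa : 'I_s -> nat -> 'cV['F_2]_2) :
  (forall j l, (L <= l)%N -> kappa j l = 0) ->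
  (forall xi : 'rV_2, xi != 0 -> exists j l, xi *m kappa j l != 0) ->
  ((\sum_(c : mats) #|solutions kappa c|) * 2 ^ (2 * m)
    <= 5 * (#|{: mats}| * #|{: arrays}|))%N.
Proof.
move=> kL k_span.
have -> : (\sum_(c : mats) #|solutions kappa c| = \sum_(N : arrays)
    #|[set c : mats |
      (\sum_j row_comb kappa (unitriangular N) j *m c j == 0)%R]%SET|)%N.
  under eq_bigr do rewrite -sum1_card big_mkcond.
  under [RHS]eq_bigr do rewrite -sum1_card big_mkcond.
  rewrite exchange_big; apply: eq_bigr => N _; apply: eq_bigr => c _.
  by rewrite !inE.
rewrite big_distrl/=.
apply: leq_trans (leq_sum _ (fun N _ => card_left_kernel_rank _)) _.
rewrite -big_distrr/= mulnCA leq_mul2l; apply/orP; right.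
rewrite !big_split/= sum1_card -!big_distrr/=.
rewrite (_ : 5 = 1 + 3 + 1)%N// !mulnDl !mul1n; apply: leq_add; last first.
  rewrite mulnC; apply: leq_trans (card_row_comb_eq0 kL k_span).
  rewrite leq_mul2r -sum1_card [leqRHS]big_mkcond /=; apply/orP; right.
  by apply: leq_sum => N _; rewrite inE; case: [forall _, _].
rewrite leq_add2l exchange_big big_distrr /=.
apply: (@leq_trans (\sum_(xi : 'rV['F_2]_2 | xi != 0%R) #|{: arrays}|)).
  apply: leq_sum => xi xi0; rewrite mulnC.
  have : forall zeta : 'rV['F_2]_1, zeta != 0 ->
      exists j l, zeta *m (xi *m kappa j l) != 0.
    move=> zeta zeta0; have [j [l xil]] := k_span xi xi0; exists j, l.
    move: zeta0; rewrite [zeta]mx11_scalar mul_scalar_mx scalemx_eq0.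
    by rewrite (negPf xil) orbF; apply: contraNneq => ->; rewrite raddf0.
  move=> /card_row_comb_eq0; rewrite mul1n => card_xi.
  apply: leq_trans (card_xi _); last by move=> j l /kL->; rewrite mulmx0.
  rewrite leq_mul2r -sum1_card [leqRHS]big_mkcond /=; apply/orP; right.
  apply: leq_sum => N _; rewrite inE.
  by under eq_forallb do rewrite -row_combZ; case: [forall _, _].
rewrite sum_nat_const leq_mul2r; apply/orP; right.
have -> : 3%N = #|predC1 (0 : 'rV['F_2]_2)| by rewrite cardC1 card_mx card_Fp.
by apply/subset_leq_card/fintype.subsetP => xi; rewrite !inE.
Qed.

End unitriangular_matrices.

Arguments solutions {s m} L {r} kappa c.

(** * Vectors with two coordinates in F_2 *)

Lemma F2_cases (x : 'F_2) : x = 0 \/ x = 1.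
Proof. by case: x => [[|[|//]]] i; [left|right]; exact: val_inj. Qed.

Lemma ord2_cases (a : 'I_2) : a = 0 \/ a = 1.
Proof. by case: a => [[|[|//]]] ?; [left|right]; exact: val_inj. Qed.

Lemma mul_rV2_cV2 (F : nzRingType) (xi : 'rV[F]_2) (k : 'cV[F]_2) :
  (xi *m k) 0 0 = xi 0 0 * k 0 0 + xi 0 1 * k 1 0.
Proof.
rewrite mxE !big_ord_recl big_ord0 addr0.
by rewrite (_ : lift ord0 ord0 = 1)//; exact: val_inj.
Qed.

(** The orthogonal of a nonzero vector k of F_2^2 is a line, hence consists of 0
    and one other vector. *)
Lemma annihilator_F2 (k : 'cV['F_2]_2) : k != 0 ->
  exists2 xi0 : 'rV_2, xi0 *m k = 0 &
    forall xi : 'rV_2, xi != 0 -> xi != xi0 -> xi *m k != 0.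
Proof.
move=> k_neq0.
have k0 : k 0 0 = 0 -> k 1 0 = 0 -> False.
  move=> k0 k1; case/eqP: k_neq0.
  by apply/colP => a; rewrite mxE; case: (ord2_cases a) => ->.
pose xi0 : 'rV['F_2]_2 := \row_i if i == 0 then k 1 0 else k 0 0.
exists xi0 => [|xi xi_neq0 /eqP xi_neq].
  apply/colP => a; rewrite ord1 mul_rV2_cV2 [RHS]mxE !mxE /=.
  by case: (F2_cases (k 0 0)) (F2_cases (k 1 0)) => -> [] ->; exact: val_inj.
have xi_0 : xi 0 0 = 0 -> xi 0 1 = 0 -> False.
  move=> x0 x1; case/eqP: xi_neq0.
  by apply/rowP => a; rewrite mxE; case: (ord2_cases a) => ->.
apply/eqP => /colP/(_ 0); rewrite mul_rV2_cV2 [RHS]mxE => xik; apply: xi_neq.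
have [x0 x1] : xi 0 0 = k 1 0 /\ xi 0 1 = k 0 0.
  move: xik k0 xi_0; case: (F2_cases (k 0 0)) (F2_cases (k 1 0))
    (F2_cases (xi 0 0)) (F2_cases (xi 0 1)) => -> [] -> [] -> [] -> h k0 xi_0;
    first [by split | by case: (k0 erefl erefl) | by case: (xi_0 erefl erefl)
          | by move/eqP: h].
by apply/rowP => a; rewrite mxE; case: (ord2_cases a) => ->.
Qed.

(** * Fourier analysis of the number of solutions *)

Section fourier.
Variable R : realType.

Definition sgnF2 (x : 'F_2) : R := if x == 0 then 1 else -1.

Lemma sgnF2D : {morph sgnF2 : x y / x + y >-> x * y}.
Proof.
move=> x y; rewrite /sgnF2.
by case: (F2_cases x) (F2_cases y) => -> [] -> /=;
  rewrite ?mulrNN ?mulr1 ?mul1r.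
Qed.

Lemma sgnF2_0 : sgnF2 0 = 1.
Proof. by rewrite /sgnF2 eqxx. Qed.

Lemma sgnF2_sum (I : Type) (r : seq I) (P : pred I) (F : I -> 'F_2) :
  sgnF2 (\sum_(i <- r | P i) F i) = \prod_(i <- r | P i) sgnF2 (F i).
Proof. exact: (big_morph _ sgnF2D sgnF2_0). Qed.

Lemma sum_F2 (f : 'F_2 -> R) : \sum_x f x = f 0 + f 1.
Proof.
rewrite (bigD1 0)//=; congr (_ + _); rewrite (bigD1 1)//= big1 ?addr0//.
by move=> x /andP[]; case: (F2_cases x) => ->.
Qed.

(** Orthogonality of characters: every additive character of the space of
    matrices A is the sign of tr (Y A) for some Y. *)
Lemma sum_sgnF2 (m r : nat) (A : 'M['F_2]_(r, m)) :
  \sum_(Y : 'M['F_2]_(m, r)) sgnF2 (\tr (Y *m A)) =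
  if A == 0 then (2 ^ (m * r))%:R else 0.
Proof.
case: eqP => [->|/eqP A0].
  under eq_bigr do rewrite mulmx0 mxtrace0 sgnF2_0.
  by rewrite sumr_const card_mx card_Fp.
have [[a b] Aab] : exists u, A u.1 u.2 != 0.
  apply/existsP; apply: contraR A0 => /existsPn A0.
  by apply/eqP/matrixP => a b; have /negPn/eqP/= := A0 (a, b); rewrite mxE.
have trA : sgnF2 (\tr (delta_mx b a *m A)) = -1.
  rewrite mxtrace_mulC /mxtrace (bigD1 a)//= big1 => [|c ca]; last first.
    by rewrite mxE big1// => d _; rewrite mxE (negPf ca) andbF mulr0.
  rewrite mxE (bigD1 b)//= big1 => [|d db]; last first.
    by rewrite mxE (negPf db) mulr0.
  by rewrite mxE !eqxx mulr1 !addr0 /sgnF2 (negPf Aab).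
set S := LHS; suff /eqP : S = - S.
  by rewrite -addr_eq0 -mulr2n mulrn_eq0 => /eqP.
rewrite -mulN1r mulr_sumr {1}/S (reindex_inj (addIr (delta_mx b a))) /=.
by apply: eq_bigr => Y _; rewrite mulmxDl mxtraceD sgnF2D trA mulrC.
Qed.

(** The mean of the sign of t times the entry (l, i) of a random unitriangular
    matrix: the entry is a random bit, 1, or 0. *)
Definition entry_mean (l i : nat) (t : 'F_2) : R :=
  if (i < l)%N then (t == 0)%:R else if l == i then sgnF2 t else 1.

(** The mean of the sign of entry i of a random combination of rows whose
    coefficients have length p. *)
Definition column_mean (p i : nat) : R :=
  if (p <= i)%N then 1 else if p == i.+1 then -1 else 0.

(** A nonzero coefficient after i makes the mean vanish, and otherwise only the
    coefficient i matters: it is 1 if the length is i + 1 and 0 if it is less. *)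
Lemma prod_entry_mean (L i p : nat) (t : nat -> 'cV['F_2]_1) :
  digit_length t p -> (p <= L)%N ->
  \prod_(l < L) entry_mean l i (t l 0 0) = column_mean p i.
Proof.
move=> [tp tp1] pL; rewrite /column_mean /entry_mean; case: leqP => [pi|ip].
  rewrite big1// => l _; case: ltnP => [il|li].
    by rewrite tp ?mxE ?eqxx// (leq_trans pi (ltnW il)).
  by case: eqP => // le; rewrite tp ?le// mxE sgnF2_0.
have p0 : (0 < p)%N by exact: leq_ltn_trans ip.
have t1 : t p.-1 0 0 != 0.
  by apply: contraNneq (tp1 p0) => t0; apply/eqP/colP => a; rewrite ord1 t0 mxE.
have p1L : (p.-1 < L)%N by rewrite prednK.
rewrite (bigD1 (Ordinal p1L))//=; have [pi|pi] := eqVneq p i.+1.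
  have pE : p.-1 = i by rewrite pi.
  rewrite ifF ?pE ?ltnn// ifT ?pE// big1 ?mulr1.
    by rewrite /sgnF2 (negPf t1).
  move=> l /eqP/val_eqP/=; rewrite pE => /negPf ->.
  by case: ltnP => // il; rewrite tp ?pi// mxE eqxx.
rewrite ifT ?(negPf t1) ?mul0r//.
by rewrite -ltnS prednK// ltn_neqAle eq_sym pi.
Qed.

Section counting.
Variables (s m L : nat).
Local Notation mats := {ffun 'I_s -> 'M['F_2]_m}.
Local Notation arrays := {ffun 'I_s * 'I_L * 'I_m -> 'F_2}.

Lemma sum_sgnF2_arrays (e : 'I_s -> 'I_L -> 'I_m -> 'F_2) :
  \sum_(N : arrays) \prod_j \prod_l \prod_i
    sgnF2 (unitriangular N (j, l, i) * e j l i) =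
  #|{: arrays}|%:R *
    \prod_j \prod_(i < m) \prod_(l < L) entry_mean l i (e j l i).
Proof.
pose G (u : 'I_s * 'I_L * 'I_m) (x : 'F_2) := sgnF2
  ((if (u.2 < u.1.2)%N then x else ((u.1.2 : nat) == u.2)%:R) *
   e u.1.1 u.1.2 u.2).
transitivity (\sum_(N : arrays) \prod_u G u (N u)).
  apply: eq_bigr => N _; rewrite pair_bigA /= pair_bigA /=.
  by apply: eq_bigr => -[[j l] i] _; rewrite ffunE.
rewrite -(bigA_distr_bigA G) /=.
transitivity (\prod_(u : 'I_s * 'I_L * 'I_m)
    (2 * entry_mean u.1.2 u.2 (e u.1.1 u.1.2 u.2)) : R).
  apply: eq_bigr => -[[j l] i] _ /=; rewrite sum_F2 /G /= /entry_mean.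
  case: ltnP => il.
    rewrite mul0r mul1r sgnF2_0 /sgnF2; case: eqP => _.
      by rewrite mulr1 -mulr2n.
    by rewrite mulr0 subrr.
  by case: eqP => le; rewrite ?mul0r ?mul1r ?sgnF2_0 ?mulr1 -mulr2n// mulr_natl.
rewrite big_split /= prodr_const card_ffun card_Fp// natrX; congr (_ * _).
under [RHS]eq_bigr do rewrite exchange_big /=.
by rewrite pair_bigA /= pair_bigA.
Qed.

(** Since tr (Y V_j c_j) = tr (c_j Y V_j), the sign of tr (Y sum_j V_j c_j) is a
    product over the independent entries (j, l, i), the coefficient of the entry
    being the value at kappa_{j,l} of the linear form row i of c_j Y. *)
Lemma card_solutions_fourier (r : nat) (kappa : 'I_s -> nat -> 'cV['F_2]_r)
    (c : mats) :
  #|solutions L kappa c|%:R * (2 ^ (m * r))%:R =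
  #|{: arrays}|%:R * \sum_(Y : 'M['F_2]_(m, r))
    \prod_j \prod_(i < m) \prod_(l < L)
      entry_mean l i ((row i (c j *m Y) *m kappa j l) 0 0).
Proof.
rewrite mulr_sumr; under [RHS]eq_bigr => Y _ do rewrite -sum_sgnF2_arrays.
rewrite exchange_big /= -sum1_card natr_sum big_mkcond /= mulr_suml.
apply: eq_bigr => N _; rewrite inE.
transitivity (\sum_(Y : 'M['F_2]_(m, r))
    sgnF2 (\tr (Y *m \sum_j row_comb kappa (unitriangular N) j *m c j))).
  by rewrite sum_sgnF2; case: eqP; rewrite ?mul1r ?mul0r.
apply: eq_bigr => Y _.
rewrite mulmx_sumr raddf_sum /= sgnF2_sum; apply: eq_bigr => j _.
rewrite mxtrace_mulC -mulmxA mulmx_suml raddf_sum /= sgnF2_sum.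
apply: eq_bigr => l _; rewrite -mulmxA mxtrace_mulC /mxtrace big_ord1.
rewrite -mulmxA mxE sgnF2_sum; apply: eq_bigr => i _.
by congr (sgnF2 (_ * _)); [rewrite mxE|rewrite -row_mul [RHS]mxE].
Qed.

Local Notation coltype := ('rV['F_2]_2 * 'I_m.+2 * 'I_m.+2)%type.

(** A type (xi0, p, q) records the lengths of xi t for the three nonzero xi in
    F_2^2: p for xi0 and q for the two others.  Lengths are capped at m + 1,
    because only comparisons with i + 1 <= m matter. *)
Definition type_mean (tau : coltype) (i : nat) (xi : 'rV['F_2]_2) : R :=
  if xi == 0 then 1 else
  column_mean (if xi == tau.1.1 then tau.1.2 else tau.2) i.

Lemma column_mean_cap (p i : nat) :
  (i < m)%N -> column_mean (minn p m.+1) i = column_mean p i.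
Proof.
move=> im; rewrite /column_mean geq_min.
rewrite [(m < i)%N]ltnNge (ltnW im) orbF; case: leqP => // ip.
congr (if _ then _ else _); rewrite /minn; case: ltnP => // mp.
by rewrite !gtn_eqF//; exact: leq_ltn_trans im mp.
Qed.

(** Let q be the length of t.  Its last nonzero term t_{q-1} is annihilated by a
    single nonzero xi0, so every other xi t has length q as well. *)
Lemma type_mean_exists (t : nat -> 'cV['F_2]_2) :
  (forall l, (L <= l)%N -> t l = 0) ->
  exists tau : coltype, forall (i : 'I_m) xi,
    \prod_(l < L) entry_mean l i ((xi *m t l) 0 0) = type_mean tau i xi.
Proof.
move=> tL; have [q [tq tq1] qL] := digit_length_exists tL.
have xiL xi l : (L <= l)%N -> xi *m t l = 0 :> 'cV_1.
  by move/tL ->; rewrite mulmx0.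
have cap p : (minn p m.+1 < m.+2)%N by rewrite ltnS geq_minr.
have w0 (i : 'I_m) :
    \prod_(l < L) entry_mean l i (((0 : 'rV_2) *m t l) 0 0) = 1.
  rewrite big1// => l _; rewrite /entry_mean mul0mx mxE eqxx sgnF2_0.
  by case: ifP => //; case: ifP.
have [q0|q0] := posnP q.
  exists (0, Ordinal (cap 0%N), Ordinal (cap 0%N)) => i xi.
  rewrite [RHS](_ : _ = 1); last by rewrite /type_mean /column_mean /= !if_same.
  rewrite -[RHS](w0 i); apply: eq_bigr => l _.
  by rewrite tq ?q0// !mulmx0.
have [xi0 xi0k xi0P] := annihilator_F2 (tq1 q0).
have [p tp pL] := digit_length_exists (xiL xi0).
exists (xi0, Ordinal (cap p), Ordinal (cap q)) => i xi.
rewrite /type_mean /=; have [->|xi_neq0] := eqVneq; first exact: w0.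
have [xiE|xi_neq] := eqVneq; rewrite column_mean_cap//.
  by apply: (@prod_entry_mean L i p (fun l => xi *m t l)) => //; rewrite xiE.
apply: (@prod_entry_mean L i q (fun l => xi *m t l)) => //.
split=> [l /tq->|_]; first by rewrite mulmx0.
exact: xi0P.
Qed.

(** Fourier inversion: up to the factor 4^m, this is the probability that
    sum_j V_j c_j = 0 when the j-th digit family has type tau j. *)
Definition type_char_sum (tau : {ffun 'I_s -> coltype}) (c : mats) : R :=
  \sum_(Y : 'M['F_2]_(m, 2)) \prod_j \prod_(i < m)
    type_mean (tau j) i (row i (c j *m Y)).

Lemma solutions_type (kappa : 'I_s -> nat -> 'cV['F_2]_2) :
  (forall j l, (L <= l)%N -> kappa j l = 0) ->
  exists tau, forall c, #|solutions L kappa c|%:R / #|{: arrays}|%:R =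
    type_char_sum tau c / (2 ^ (2 * m))%:R.
Proof.
move=> kL; have /choice[tau tauP] := fun j => type_mean_exists (kL j).
exists [ffun j => tau j] => c.
have arrays_neq0 : #|{: arrays}|%:R != 0 :> R.
  by rewrite pnatr_eq0 -lt0n; apply/card_gt0P; exists [ffun=> 0].
have exp0 : (2 ^ (2 * m))%:R != 0 :> R by rewrite pnatr_eq0 expn_eq0.
apply/eqP; rewrite eqr_div//; apply/eqP.
rewrite [X in (2 ^ X)%N]mulnC card_solutions_fourier mulrC; congr (_ * _).
apply: eq_bigr => Y _; apply: eq_bigr => j _; apply: eq_bigr => i _.
by rewrite ffunE -tauP.
Qed.

End counting.
End fourier.

(** * The law of the random model *)

Section finite_laws.
Context (d : measure_display) (Omega : measurableType d) (R : realType).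
Variable P : probability Omega R.

Lemma prob_finite_union (T : finType) (B : set Omega) (Y : Omega -> T) :
  (forall t, measurable (B `&` Y @^-1` [set t])) -> forall A : {set T},
  P (B `&` [set w | Y w \in A]) = (\sum_(t in A) P (B `&` Y @^-1` [set t]))%E.
Proof.
move=> mY A; rewrite -big_enum /= fsbig_seq ?enum_uniq// -measure_fin_bigcup.
- congr (P _); apply/seteqP; split=> w /=.
    by move=> [Bw YA]; exists (Y w) => //=; rewrite mem_enum.
  by move=> [t /=]; rewrite mem_enum => tA [Bw Yw]; split=> //; rewrite Yw.
- exact: finite_seq.
- by move=> t t' _ _ [w /= [[_ <-] [_ <-]]].
- by move=> t _; exact: mY.
Qed.

Lemma independent_seq (I : choiceType) (D : set I) (F : I -> set (set Omega))
    (E : I -> set Omega) (r : seq I) :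
  mutually_independent P D F -> uniq r ->
  (forall i, i \in r -> D i /\ F i (E i)) ->
  P [set w | forall i, i \in r -> E i w] = (\prod_(i <- r) P (E i))%E.
Proof.
move=> indep r_uniq rE.
have [J JE J_perm] : exists2 J : {fset I}, J =i r & perm_eq J r.
  exists (seq_fset tt r); first exact: seq_fsetE.
  by rewrite -{2}(undup_id r_uniq); exact: seq_fset_perm.
rewrite -(perm_big _ J_perm) -indep.
- congr (P _); apply/seteqP; split=> w /= Ew i; have := Ew i.
    by move=> Ei ri; apply: Ei; move: ri; rewrite /= JE.
  by move=> Ei ri; apply: Ei; rewrite /= JE.
- by move=> i /=; rewrite JE => /rE[].
- by move=> i; rewrite JE => /rE[].
Qed.

End finite_laws.

Section joint_law.
Context (d : measure_display) (Omega : measurableType d) (R : realType).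
Variables (P : probability Omega R) (s m L : nat).
Variables (C : Omega -> {ffun 'I_s -> 'M['F_2]_m})
          (M : 'I_s -> Omega -> nat -> 'rV['F_2]_m).
Hypothesis CM : random_model P C M.
Local Notation mats := {ffun 'I_s -> 'M['F_2]_m}.
Local Notation arrays := {ffun 'I_s * 'I_L * 'I_m -> 'F_2}.

Definition truncation (w : Omega) : arrays :=
  [ffun u : 'I_s * 'I_L * 'I_m => M u.1.1 w u.1.2 0 u.2].

Lemma truncation_above (w : Omega) (u : 'I_s * 'I_L * 'I_m) :
  ~~ below u -> truncation w u = ((u.1.2 : nat) == u.2)%:R.
Proof.
case: u => [[j l] i]; rewrite /below -leqNgt ffunE /= leq_eqVlt.
by case: eqP => [-> _|_ /= li]; rewrite ?(M_diag CM) ?(M_above CM).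
Qed.

(** Mutual independence is applied to the s matrices C_j and to the entries below
    the diagonal in the first L rows; r lists their indices. *)
Lemma prob_lower_entries (c : mats) (X : arrays) :
  P [set w | C w = c /\ forall u, below u -> truncation w u = X u] =
  (#|{: mats}|%:R^-1 * \prod_(u : 'I_s * 'I_L * 'I_m | below u) 2^-1)%:E.
Proof.
pose I := ('I_s + 'I_s * nat * 'I_m)%type.
pose h (u : 'I_s * 'I_L * 'I_m) : I := inr (u.1.1, u.1.2 : nat, u.2).
have h_inj : injective h by move=> [[j l] i] [[j' l'] i'] [-> /val_inj -> ->].
pose r := map (@inl _ _) (enum 'I_s) ++ map h (enum (@below s m L)).
pose E (x : I) : set Omega :=
  match x with
  | inl j => [set w | C w j = c j]
  | inr (j, l, i) => [set w | forall l' : 'I_L, l' = l :> nat ->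
      M j w l 0 i = X (j, l', i)]
  end.
have r_uniq : uniq r.
  rewrite cat_uniq !map_inj_uniq ?enum_uniq ?andbT ?andTb//; last first.
    by move=> ? ? [].
  rewrite -enumT enum_uniq /=.
  by apply/negP => /hasP[_ /mapP[u _ ->] /mapP[]].
have Eh u : E (h u) = [set w | M u.1.1 w u.1.2 0 u.2 = X u].
  case: u => [[j l] i]; apply/seteqP; split=> w /=; first exact.
  by move=> e l' /val_inj->.
rewrite (_ : [set w | _] = [set w | forall x, x \in r -> E x w]); last first.
  apply/seteqP; split=> w /=.
    move=> [Cw Mw] x.
    rewrite mem_cat => /orP[] /mapP[u]; rewrite mem_enum => hu ->.
      by rewrite /E /= Cw.
    by rewrite Eh /= -Mw// ffunE.
  move=> Ew; split=> [|u lu].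
    by apply/ffunP => j; apply: (Ew (inl j)); rewrite mem_cat map_f ?mem_enum.
  have : E (h u) w by apply: Ew; rewrite mem_cat map_f ?orbT// mem_enum.
  by rewrite Eh ffunE.
rewrite (independent_seq (CM_independent CM) r_uniq); last first.
  move=> x; rewrite mem_cat => /orP[] /mapP[u]; rewrite mem_enum => hu ->.
    by split=> //; exists [set c u] => //; rewrite setTI.
  split; first by case: u hu => [[? ?] ?].
  rewrite Eh /h; exists [set X u] => //; rewrite setTI//.
transitivity ((\prod_(j < s) (#|{: 'M['F_2]_m}|%:R^-1)%:E) *
    \prod_(u : 'I_s * 'I_L * 'I_m | below u) (2^-1)%:E : \bar R)%E.
  rewrite big_cat !big_map !big_enum; congr (_ * _)%E; apply: eq_bigr => u hu.
    exact: (C_uniform CM u).2.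
  by rewrite Eh; have := (M_below CM u.1.1 hu).2 (X u); rewrite card_Fp.
rewrite !prodEFin -EFinM; congr (_ * _)%:E.
by rewrite prodr_const card_ffun card_ord natrX exprVn.
Qed.

(** The left side is a product over the entries: a random bit has a prescribed
    value with probability 1/2, and the other entries agree with X. *)
Lemma card_unitriangular_fiber (X : arrays) :
  (forall u : 'I_s * 'I_L * 'I_m,
    ~~ below u -> X u = ((u.1.2 : nat) == u.2)%:R) ->
  #|[set N | unitriangular N == X]%SET|%:R / #|{: arrays}|%:R =
  \prod_(u : 'I_s * 'I_L * 'I_m | below u) 2^-1 :> R.
Proof.
move=> X_diag; pose G u (x : 'F_2) : R := if below u then (x == X u)%:R else 1.
rewrite -sum1_card natr_sum big_mkcond /=.
transitivity ((\sum_(N : arrays) \prod_u G u (N u)) / #|{: arrays}|%:R).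
  congr (_ / _); apply: eq_bigr => N _; rewrite inE; case: eqP => [NX|NX].
    rewrite big1// => u _; rewrite /G; case: ifP => // lu.
    by rewrite -NX ffunE lu eqxx.
  apply/esym/eqP; rewrite prodf_seq_eq0; apply/hasP.
  have [u NXu] : exists u, unitriangular N u != X u.
    apply/existsP; apply: contra_notT NX => /existsPn NX; apply/ffunP => u.
    exact/eqP/negPn/NX.
  exists u; rewrite ?mem_index_enum//= /G; move: NXu; rewrite ffunE.
  case: ifP => [_ /negPf->|/negbT/X_diag ->]; rewrite eqxx//.
rewrite -(bigA_distr_bigA G) /= card_ffun card_Fp// natrX.
rewrite -prodr_const -prodf_div.
rewrite [RHS]big_mkcond /=; apply: eq_bigr => u _; rewrite sum_F2 /G.
case: ifP => _; last by rewrite -mulr2n divff// pnatr_eq0.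
by case: (F2_cases (X u)) => ->; rewrite ?addr0 ?add0r mul1r.
Qed.

(** The law of (C, truncation of M) is that of (c, unitriangular N) for (c, N)
    uniform, including at the arrays X that are not unitriangular, where both
    sides vanish. *)
Lemma joint_law (c : mats) (X : arrays) :
  P [set w | C w = c /\ truncation w = X] =
  (#|[set N | unitriangular N == X]%SET|%:R /
    (#|{: mats}|%:R * #|{: arrays}|%:R))%:E.
Proof.
have [X_diag|] := pselect (forall u : 'I_s * 'I_L * 'I_m,
    ~~ below u -> X u = ((u.1.2 : nat) == u.2)%:R).
  rewrite invfM mulrCA card_unitriangular_fiber// -(prob_lower_entries c X).
  congr (P _); apply/seteqP; split=> w /= [-> wX]; split=> //.
    by rewrite wX.
  apply/ffunP => u; have [/wX//|lu] := boolP (below u).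
  by rewrite truncation_above// X_diag.
move=> /existsNP[u /not_implyP[lu Xu]].
rewrite (_ : [set w | _] = set0); last first.
  apply/seteqP; split=> w //= [_ wX]; apply: Xu.
  by rewrite -wX truncation_above.
rewrite measure0 (_ : [set N | unitriangular N == X]%SET = finset.set0).
  by rewrite cards0 mul0r.
apply/setP => N; rewrite !inE; apply/eqP => NX; apply: Xu.
by rewrite -NX ffunE (negPf lu).
Qed.

Lemma measurable_C (c : mats) : measurable [set w | C w = c].
Proof.
rewrite (_ : [set w | _] = \bigcap_(j in [set: 'I_s]) [set w | C w j = c j]).
  apply: fin_bigcap_measurable => // j _; apply: (C_uniform CM j).1.
  by exists [set c j] => //; rewrite setTI.
apply/seteqP; split=> w /= Cw; first by move=> j _ /=; rewrite Cw.
apply/ffunP => j; exact: Cw.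
Qed.

Lemma measurable_joint (c : mats) (X : arrays) :
  measurable [set w | C w = c /\ truncation w = X].
Proof.
apply: measurableI; first exact: measurable_C.
rewrite [A in measurable A](_ : _ = \bigcap_(u in [set: 'I_s * 'I_L * 'I_m])
    [set w | truncation w u = X u]).
  apply: fin_bigcap_measurable => // u _; have [lu|lu] := boolP (below u).
    rewrite (_ : [set w | _] = [set w | M u.1.1 w u.1.2 0 u.2 = X u]).
      apply: (M_below CM u.1.1 lu).1.
      by exists [set X u] => //; rewrite setTI.
    by apply/seteqP; split=> w /=; rewrite ffunE.
  have [Xu|Xu] := eqVneq (X u) ((u.1.2 : nat) == u.2)%:R.
    rewrite (_ : [set w | _] = setT)//; apply/seteqP; split=> w //= _.
    by rewrite truncation_above.
  rewrite (_ : [set w | _] = set0)//; apply/seteqP; split=> w //=.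
  by rewrite truncation_above// => /esym/eqP; rewrite (negPf Xu).
apply/seteqP; split=> w /= wX; first by move=> u _ /=; rewrite wX.
apply/ffunP => u; exact: wX.
Qed.

Lemma prob_C_truncation (c : mats) (Q : pred arrays) :
  P [set w | C w = c /\ Q (truncation w)] =
  (#|[set N | Q (unitriangular N)]%SET|%:R /
    (#|{: mats}|%:R * #|{: arrays}|%:R))%:E.
Proof.
transitivity (P ([set w | C w = c] `&`
    [set w | truncation w \in [set X | Q X]%SET])).
  by congr (P _); apply/seteqP; split=> w /=; rewrite inE.
rewrite prob_finite_union; last by move=> X; exact: measurable_joint.
rewrite (eq_bigr _ (fun X _ => joint_law c X)) sumEFin -mulr_suml.
congr ((_ / _)%:E).
rewrite -natr_sum; congr (_%:R); rewrite -[RHS]sum1_card.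
rewrite (eq_bigl Q); last by move=> X; rewrite inE.
rewrite [RHS](partition_big (@unitriangular s m L) Q) /=; last first.
  by move=> N; rewrite inE.
apply: eq_bigr => X QX; rewrite -sum1_card; apply: eq_bigl => N.
by rewrite !inE andbC; case: eqP => // ->.
Qed.

End joint_law.

Arguments truncation {d Omega s m} L M w.

Section digits.
Variables (s m : nat).

Definition pair_digits (k1 k2 : {ffun 'I_s -> nat}) (j : 'I_s) (l : nat) :
    'cV['F_2]_2 :=
  \col_a (if a == 0 then digit (k1 j) l else digit (k2 j) l).

Lemma digits_mul_widen (L k : nat) (A : nat -> 'rV['F_2]_m) : (k <= L)%N ->
  digits_mul k A = \sum_(l < L) digit k l *: A l.
Proof.
move=> kL; rewrite /digits_mul (big_ord_widen L (fun l => digit k l *: A l))//.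
rewrite big_mkcond; apply: eq_bigr => l _; case: ltnP => // kl.
by rewrite digit_eq0// scale0r.
Qed.

Lemma digit_inj (k k' : nat) : (forall l, digit k l = digit k' l) -> k = k'.
Proof.
have [n] := ubnP (maxn k k'); elim: n k k' => // n IH k k' le_n kk'.
have odd_kk' : odd k = odd k'.
  have /eqP := kk' 0%N; rewrite /digit !divn1.
  by case: (odd k) (odd k') => [] [].
have half_kk' : k./2 = k'./2.
  have [//|k_neq] := eqVneq k k'; first by move=> ->.
  apply: IH; first by lia.
  by move=> l; have := kk' l.+1; rewrite /digit expnS !divnMA !divn2.
by rewrite -(odd_double_half k) odd_kk' half_kk' odd_double_half.
Qed.

(** The three nonzero xi give the digits of k1, of k2 and of k1 xor k2. *)
Lemma pair_digits_span (k1 k2 : {ffun 'I_s -> nat}) :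
  k1 != k2 -> k1 != [ffun=> 0%N] -> k2 != [ffun=> 0%N] ->
  forall xi : 'rV_2, xi != 0 -> exists j l, xi *m pair_digits k1 k2 j l != 0.
Proof.
move=> k12 k1_neq0 k2_neq0 xi; apply: contra_neqP => /forallNP xi_k.
have {}xi_k j l : xi 0 0 * digit (k1 j) l + xi 0 1 * digit (k2 j) l = 0.
  have /forallNP/(_ l)/negP/negPn/eqP/colP/(_ 0) := xi_k j.
  by rewrite mul_rV2_cV2 !mxE.
have digit0 (k : {ffun 'I_s -> nat}) :
    (forall j l, digit (k j) l = 0) -> k = [ffun=> 0%N].
  move=> kd; apply/ffunP => j; rewrite ffunE; apply: digit_inj => l.
  by rewrite kd digit_eq0.
suff [x0 x1] : xi 0 0 = 0 /\ xi 0 1 = 0.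
  by apply/rowP => a; rewrite mxE; case: (ord2_cases a) => ->.
case: (F2_cases (xi 0 0)) (F2_cases (xi 0 1)) xi_k => -> [] -> xi_k //.
- case/eqP: k2_neq0; apply: digit0 => j l.
  by have := xi_k j l; rewrite mul0r mul1r add0r.
- case/eqP: k1_neq0; apply: digit0 => j l.
  by have := xi_k j l; rewrite mul0r mul1r addr0.
- case/eqP: k12; apply/ffunP => j; apply: digit_inj => l.
  have := xi_k j l; rewrite !mul1r.
  by case: (F2_cases (digit (k1 j) l)) (F2_cases (digit (k2 j) l)) => -> [] ->.
Qed.

Lemma pair_digits_eq0 (k1 k2 : {ffun 'I_s -> nat}) (j : 'I_s) (l : nat) :
  (k1 j <= l)%N -> (k2 j <= l)%N -> pair_digits k1 k2 j l = 0.
Proof.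
by move=> kl1 kl2; apply/colP => a; rewrite !mxE !digit_eq0// if_same.
Qed.

End digits.

Section conditional_law.
Context (d : measure_display) (Omega : measurableType d) (R : realType).
Variables (P : probability Omega R) (s m : nat).
Variables (C : Omega -> {ffun 'I_s -> 'M['F_2]_m})
          (M : 'I_s -> Omega -> nat -> 'rV['F_2]_m).
Hypothesis CM : random_model P C M.
Local Notation mats := {ffun 'I_s -> 'M['F_2]_m}.

Lemma prob_C_eq (c : mats) : P [set w | C w = c] = (#|{: mats}|%:R^-1)%:E.
Proof.
pose Q := predT : pred {ffun 'I_s * 'I_0 * 'I_m -> 'F_2}.
transitivity (P [set w | C w = c /\ Q (truncation 0 M w)]).
  by congr (P _); apply/seteqP; split=> w //= -[].
rewrite (prob_C_truncation CM) (_ : [set N | _]%SET = finset.setT); last first.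
  by apply/setP => N; rewrite !inE.
rewrite cardsT invfM mulrCA divff ?mulr1// pnatr_eq0 -lt0n.
by apply/card_gt0P; exists 0.
Qed.

Lemma prob_C_in (A : {set mats}) :
  P [set w | C w \in A] = (#|A|%:R / #|{: mats}|%:R)%:E.
Proof.
rewrite -[X in P X]setTI prob_finite_union; last first.
  by move=> c; rewrite setTI; exact: (measurable_C CM).
under eq_bigr do rewrite setTI prob_C_eq.
by rewrite sumEFin sumr_const mulr_natl.
Qed.

Variable L : nat.
Local Notation arrays := {ffun 'I_s * 'I_L * 'I_m -> 'F_2}.

Lemma cond_prob_event_Z (k1 k2 : {ffun 'I_s -> nat}) (c : mats) :
  (forall j, k1 j <= L)%N -> (forall j, k2 j <= L)%N ->
  cond_prob P (event_Z C M k1 `&` event_Z C M k2) [set w | C w = c] =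
  #|solutions L (pair_digits k1 k2) c|%:R / #|{: arrays}|%:R.
Proof.
move=> k1L k2L.
pose Q (X : arrays) := \sum_j row_comb (pair_digits k1 k2) X j *m c j == 0.
have ZE : event_Z C M k1 `&` event_Z C M k2 `&` [set w | C w = c] =
    [set w | C w = c /\ Q (truncation L M w)].
  have rowE w a (k : {ffun 'I_s -> nat}) : (forall j, k j <= L)%N ->
      (forall j l, pair_digits k1 k2 j l a 0 = digit (k j) l) ->
      row a (\sum_j row_comb (pair_digits k1 k2) (truncation L M w) j *m c j) =
      \sum_j digits_mul (k j) (M j w) *m c j.
    move=> kL ka; rewrite raddf_sum; apply: eq_bigr => j _ /=; rewrite row_mul.
    congr (_ *m _); rewrite raddf_sum (digits_mul_widen _ (kL j)).
    apply: eq_bigr => l _ /=.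
    apply/rowP => i; rewrite row_mul !mxE big_ord1 !mxE ffunE /=.
    by rewrite -ka mxE.
  apply/seteqP; split=> w /=.
    rewrite /event_Z /= => -[[Z1 Z2] Cw]; rewrite Cw in Z1 Z2; split=> //.
    apply/eqP/row_matrixP => a; rewrite row0.
    have [a0|a0] := eqVneq a 0; [rewrite (rowE w a k1)//|rewrite (rowE w a k2)//];
      by move=> j l; rewrite mxE ?a0 ?eqxx ?(negPf a0).
  move=> [Cw /eqP Q0]; split=> //; split; rewrite /event_Z /= Cw.
    by rewrite -(rowE w 0 k1) ?Q0 ?row0// => j l; rewrite mxE.
  by rewrite -(rowE w 1 k2) ?Q0 ?row0// => j l; rewrite mxE.
rewrite /cond_prob ZE (prob_C_truncation CM) prob_C_eq /=.
rewrite -/(solutions L (pair_digits k1 k2) c).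
rewrite invrK invfM mulrA mulrAC mulfVK//.
by rewrite pnatr_eq0 -lt0n; apply/card_gt0P; exists 0.
Qed.

End conditional_law.

(** * Markov's inequality and the union bound *)

Section union_bound.
Variables (R : realType) (s m : nat).
Local Notation mats := {ffun 'I_s -> 'M['F_2]_m}.
Local Notation coltype := ('rV['F_2]_2 * 'I_m.+2 * 'I_m.+2)%type.
Local Notation types := {ffun 'I_s -> coltype}.

(** The types of the digit families to which the average bound applies; unlike
    these families, they are finite in number. *)
Definition realizable (tau : types) : Prop :=
  exists L (kappa : 'I_s -> nat -> 'cV['F_2]_2),
  [/\ forall j l, (L <= l)%N -> kappa j l = 0,
      forall xi : 'rV_2, xi != 0 -> exists j l, xi *m kappa j l != 0 &
      forall c : mats, #|solutions L kappa c|%:R /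
        #|{: {ffun 'I_s * 'I_L * 'I_m -> 'F_2}}|%:R =
        type_char_sum R tau c / (2 ^ (2 * m))%:R].

Lemma realizable_markov (tau : types) (b : R) : realizable tau -> 0 < b ->
  #|[set c : mats | b < type_char_sum R tau c / (2 ^ (2 * m))%:R]%SET|%:R <=
  5 * #|{: mats}|%:R / (b * (2 ^ (2 * m))%:R).
Proof.
move=> [L [kappa [kL k_span tauE]]] b0.
have exp0 : (0 : R) < (2 ^ (2 * m))%:R by rewrite ltr0n expn_gt0.
have arrays_gt0 : (0 : R) < #|{: {ffun 'I_s * 'I_L * 'I_m -> 'F_2}}|%:R.
  by rewrite ltr0n; apply/card_gt0P; exists 0.
have := sum_card_solutions m kL k_span.
rewrite -(ler_nat R) !natrM natr_sum => sum_le.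
rewrite ler_pdivlMr ?mulr_gt0// mulrA.
rewrite -(ler_pM2r arrays_gt0) -[leRHS]mulrA; apply: le_trans sum_le.
rewrite mulrAC ler_pM2r// -sum1_card natr_sum !mulr_suml big_mkcond /=.
apply: ler_sum => c _; rewrite inE -tauE; case: ifP => // bc.
by rewrite mul1r -ler_pdivlMr// ltW.
Qed.

Definition good_matrices (b : R) : {set mats} :=
  [set c | ~~ [exists tau : types,
    `[< realizable tau >] &&
      (b < type_char_sum R tau c / (2 ^ (2 * m))%:R)]]%SET.

Lemma card_types : #|{: types}| = ((4 * m.+2 ^ 2) ^ s)%N.
Proof.
by rewrite card_ffun !card_prod card_mx card_Fp// !card_ord -mulnA.
Qed.

Lemma card_good_matrices (b : R) : 0 < b ->
  1 - (5 * #|{: types}|)%:R / (b * (2 ^ (2 * m))%:R) <=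
  #|good_matrices b|%:R / #|{: mats}|%:R.
Proof.
move=> b0.
have mats_gt0 : (0 : R) < #|{: mats}|%:R.
  by rewrite ltr0n; apply/card_gt0P; exists 0.
have exp0 : (0 : R) < (2 ^ (2 * m))%:R by rewrite ltr0n expn_gt0.
rewrite ler_pdivlMr// mulrBl mul1r lerBlDr -(cardsC (good_matrices b)).
rewrite natrD lerD2l.
set bad := fun tau : types =>
  [set c : mats | b < type_char_sum R tau c / (2 ^ (2 * m))%:R]%SET.
have bad_sub : (~: good_matrices b \subset
    \bigcup_(tau | `[< realizable tau >]) bad tau)%SET.
  apply/fintype.subsetP => c.
  rewrite !inE negbK => /existsP[tau /andP[tau_r btau]].
  by apply/bigcupP; exists tau => //; rewrite inE.
apply: (@le_trans _ _ (\sum_(tau | `[< realizable tau >]) #|bad tau|%:R)).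
  rewrite -natr_sum ler_nat (leq_trans (subset_leq_card bad_sub))//.
  apply: (big_ind2 (fun (A : {set mats}) n => #|A| <= n)%N); rewrite ?cards0//.
  by move=> A n B n' An Bn; rewrite (leq_trans (leq_card_setU _ _))// leq_add.
apply: (@le_trans _ _
  (\sum_(tau : types) (5 * #|{: mats}|%:R / (b * (2 ^ (2 * m))%:R)))).
  rewrite big_mkcond /=; apply: ler_sum => tau _; case: asboolP => [tau_r|_].
    exact: realizable_markov.
  by rewrite divr_ge0 ?mulr_ge0// ltW// mulr_gt0.
rewrite -natrD cardsC sumr_const -[_ *+ _]mulr_natl natrM.
rewrite le_eqVlt; apply/orP; left; apply/eqP.
by rewrite -[#|xpredT|]/(#|{: types}|); ring.
Qed.

End union_bound.

Theorem theorem7 (R : realType) (s : nat) (hs : (0 < s)%N)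
    (eps : R) (heps : 0 < eps) :
  exists m0 : nat, forall m : nat, (m0 <= m)%N ->
  forall (d : measure_display) (Omega : measurableType d)
    (P : probability Omega R)
    (C : Omega -> {ffun 'I_s -> 'M['F_2]_m})
    (M : 'I_s -> Omega -> nat -> 'rV['F_2]_m),
  random_model P C M ->
  exists Cstar : {set {ffun 'I_s -> 'M['F_2]_m}},
    ((1 - (((s.-1)`!)%:R * m%:R)^-1
        - m%:R ^+ (3 * s) * 2 `^ (- (2 * eps * m%:R)))%:E
      <= P [set w | C w \in Cstar])%E /\
    forall c : {ffun 'I_s -> 'M['F_2]_m}, c \in Cstar ->
    forall k1 k2 : {ffun 'I_s -> nat},
      k1 != k2 -> k1 != [ffun=> 0%N] -> k2 != [ffun=> 0%N] ->
      cond_prob P (event_Z C M k1 `&` event_Z C M k2) [set w | C w = c]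
        <= 2 `^ (- (2 * (1 - eps) * m%:R)).
Proof.
(* From m = 24 on, 5 * 4 * (m + 2)^2 <= m^3. *)
exists 24%N => m m24 d Omega P C M CM.
set b : R := 2 `^ (- (2 * (1 - eps) * m%:R)).
have b0 : 0 < b by exact: powR_gt0.
exists (good_matrices s m b); split; last first.
  move=> c; rewrite inE => /existsPn c_good k1 k2 k12 k1_neq0 k2_neq0.
  pose L := (\sum_j (k1 j + k2 j))%N.
  have k1L j : (k1 j <= L)%N by rewrite /L (bigD1 j)//= -addnA leq_addr.
  have k2L j : (k2 j <= L)%N by rewrite /L (bigD1 j)//= addnAC leq_addl.
  have kL j l : (L <= l)%N -> pair_digits k1 k2 j l = 0.
    by move=> Ll; rewrite pair_digits_eq0// (leq_trans _ Ll).
  have [tau tauE] := solutions_type R m kL.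
  rewrite (cond_prob_event_Z CM c k1L k2L) tauE leNgt.
  have := c_good tau; rewrite negb_and => /orP[/asboolP[]|//].
  by exists L, (pair_digits k1 k2); split=> //; exact: pair_digits_span.
rewrite (prob_C_in CM) lee_fin; apply: le_trans (card_good_matrices s m b0).
rewrite -addrA lerD2l -opprD lerN2.
have -> : b * (2 ^ (2 * m))%:R = (2 `^ (- (2 * eps * m%:R)))^-1.
  rewrite -powRN opprK natrX -powR_mulrn// -powRD ?pnatr_eq0 ?implybT//.
  congr (_ `^ _); rewrite natrM; ring.
rewrite invrK; apply: (@le_trans _ _ (m%:R ^+ (3 * s) * 2 `^ (- (2 * eps * m%:R)))).
  rewrite ler_pM2r ?powR_gt0// -natrX ler_nat card_types expnM.
  apply: (@leq_trans (5 ^ s * (4 * m.+2 ^ 2) ^ s)).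
    by rewrite leq_mul2r -{1}(expn1 5) leq_pexp2l// orbT.
  by rewrite -expnMn leq_exp2r//; nia.
by rewrite lerDr invr_ge0 mulr_ge0.
Qed.
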